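(* Let $G$ be a compact metrizable group with Borel $\sigma$-algebra $\mathcal F$, let $T:G\to G$ be a surjective continuous homomorphism, and let $\mu,\nu$ be $T$-invariant Borel probability measures on $G$. If $(G,T,\mathcal F,\mu)$ and $(G,T,\mathcal F,\nu)$ are disjoint ergodic dynamical systems, then $\mu*\nu$ is ergodic with respect to $T$.
   Context: The convolution is $\mu*\nu(E)=(\mu\times\nu)(\{(x,y)\in G\times G: xy\in E\})$ for Borel $E\subseteq G$. Two measure-preserving systems $X$ and $Y$ are disjoint (Furstenberg) if, whenever $Z$ is a measure-preserving system with factor maps $\alpha:Z\to X$ and $\beta:Z\to Y$, the $\sigma$-algebras on $Z$ obtained by pulling back those of $X$ and $Y$ via $\alpha$ and $\beta$ are independent; equivalently, the only joining of $X$ and $Y$ is the product measure. *)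

(* Defs.v *)
From HB Require Import structures.
From mathcomp Require Import all_boot all_order all_algebra.
From mathcomp Require Import finmap.
From mathcomp Require Import all_classical all_reals all_analysis.

Set Implicit Arguments.
Unset Strict Implicit.
Unset Printing Implicit Defensive.

Import Order.TTheory GRing.Theory Num.Theory.

Local Open Scope classical_set_scope.
Local Open Scope ring_scope.

(* [measurableType] requires a pointed type; a group is never empty, so asking *)
(* for a distinguished (arbitrary) point is no restriction.                    *)
HB.structure Definition PreTopologicalGroup :=
  {G of PointedTopological G & Group G}.

HB.mixin Record PreTopologicalGroup_isTopologicalGroup G
    of PreTopologicalGroup G := {
  mulg_continuous : continuous (fun z : G * G => (z.1 * z.2)%g) ;
  invg_continuous : continuous (fun x : G => (x^-1)%g)
}.

#[short(type="topologicalGroupType")]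
HB.structure Definition TopologicalGroup :=
  {G of PreTopologicalGroup G & PreTopologicalGroup_isTopologicalGroup G}.

Definition metrizable (R : realType) (X : topologicalType) : Prop :=
  exists dist : X -> X -> R,
    [/\ forall x y, dist x y = 0 <-> x = y,
        forall x y, dist x y = dist y x,
        forall x y z, dist x z <= dist x y + dist y z
      & forall x, nbhs x =
          filter_from [set e : R | 0 < e] (fun e => [set y | dist x y < e])].

Notation borel X := (g_sigma_algebraType (@open X)).

Section convolution.
Context {R : realType} {G : topologicalGroupType}.

Lemma compact_metrizable_second_countable (X : ptopologicalType) :
  compact [set: X] -> metrizable R X -> @second_countable X.
Proof.
move=> cX [dist [dist0 distC distD nbhsd]].
pose f n (z : X) : set X := [set y | dist z y < n.+1%:R^-1]^°.
have nball z (e : R) : 0 < e -> nbhs z [set y | dist z y < e].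
  by move=> e0; rewrite nbhsd; exists e.
have fz n z : f n z z by apply: nbhs_singleton (nbhs_interior _); exact: nball.
have h n : finite_subset_cover [set: X] (f n) [set: X].
  move: cX; rewrite compact_cover; apply.
  - by move=> z _; exact: open_interior.
  - by move=> z _; exists z.
have /choice[s hs] n : exists D : {fset X}, [set: X] `<=` cover [set` D] (f n).
  by have [D _ ?] := h n; exists D.
exists (\bigcup_n (f n @` [set` s n])); [|split].
- apply: bigcup_countable => // n _; apply: finite_set_countable.
  exact/finite_image/finite_fset.
- by move=> _ [n _ [z _ <-]]; exact: open_interior.
- move=> x V /=; rewrite {1}nbhsd => -[e /= e0 eV].
  have [|N] := @ltr_add_invr R 0 (e / 2); first by rewrite divr_gt0.
  rewrite add0r => Ne; have [w ws fx] := hs N x I.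
  exists (f N w) => /=; first by split => //; exists N => //; exists w.
  have fd y : f N w y -> dist w y < e / 2.
    by move=> /interior_subset /= /lt_trans; exact.
  move=> y fy; apply: eV => /=; rewrite (le_lt_trans (distD _ w _))//.
  by rewrite [ltRHS]splitr ltrD ?fd// distC fd.
Qed.

Lemma measurable_mulg : compact [set: G] -> metrizable R G ->
  measurable_fun [set: borel G * borel G]
    (fun z : borel G * borel G => ((z.1 : G) * (z.2 : G))%g : borel G).
Proof.
move=> cG mG; have [B cB [Bo Bb]] := compact_metrizable_second_countable cG mG.
apply: (@measurability _ _ (borel G * borel G)%type (borel G) _ _ (@open G)) => // _ [U oU <-]; rewrite setTI.
set W := _ @^-1` _.
pose D := [set AB : set G * set G | [/\ B AB.1, B AB.2 & AB.1 `*` AB.2 `<=` W]].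
have cD : countable D.
  by apply: sub_countable (countableX cB cB); apply: subset_card_le => AB [].
have -> : W = \bigcup_(AB in D) (AB.1 `*` AB.2).
  apply/seteqP; split; last by move=> z [AB [_ _]]; exact.
  move=> [x y] Wxy; have : nbhs ((x, y) : G * G) W.
    by apply: mulg_continuous; exact: open_nbhs_nbhs.
  move=> [[P Q] /= [/Bb [A [BA Ax] AP] /Bb [C [BC Cy] CQ]] PQ].
  exists (A, C) => //=; split => //= -[a c] [/= Aa Cc].
  by apply: PQ; split; [exact: AP|exact: CQ].
rewrite bigcup_set_type; apply: countable_bigcupT_measurable.
  by rewrite (eq_countable (card_setT _)).
move=> i; have [Bi1 Bi2 _] := set_valP i.
by apply: measurableX; apply: sub_sigma_algebra; exact: Bo.
Qed.

(* The multiplication is measurable for the product of the Borel               *)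
(* sigma-algebras because G, being compact and metrizable, is second countable.*)
Definition mulg_mfun (cG : compact [set: G]) (mG : metrizable R G) :
    {mfun (borel G * borel G)%type >-> borel G} :=
  mfun_Sub (mem_set (measurable_mulg cG mG)).

Definition convolution (cG : compact [set: G]) (mG : metrizable R G)
    (mu nu : probability (borel G) R) : probability (borel G) R :=
  distribution (mu \x nu)%E (mulg_mfun cG mG).

Lemma convolutionE cG mG mu nu (E : set G) :
  convolution cG mG mu nu E
  = (mu \x nu)%E [set z : borel G * borel G | E ((z.1 : G) * (z.2 : G))%g].
Proof. by []. Qed.

End convolution.

Section dynamical_systems.
Context {R : realType}.

Definition measure_preserving {d} {X : measurableType d}
    (mu : probability X R) (S : X -> X) : Prop :=
  measurable_fun [set: X] S /\ forall A, measurable A -> mu (S @^-1` A) = mu A.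

Definition ergodic {d} {X : measurableType d}
    (mu : probability X R) (S : X -> X) : Prop :=
  measure_preserving mu S /\
  forall A, measurable A -> S @^-1` A = A -> mu A = 0%E \/ mu A = 1%E.

(* Equivariance is only required almost everywhere, as usual for maps of       *)
(* probability spaces.                                                         *)
Definition factor_map {d d'} {Z : measurableType d} {X : measurableType d'}
    (P : probability Z R) (U : Z -> Z) (mu : probability X R) (S : X -> X)
    (alpha : Z -> X) : Prop :=
  [/\ measurable_fun [set: Z] alpha,
      forall A, measurable A -> P (alpha @^-1` A) = mu A
    & {ae P, forall z, alpha (U z) = S (alpha z)}].

Definition independent_classes {d} {Z : measurableType d}
    (P : probability Z R) (F H : set (set Z)) : Prop :=
  forall A B, F A -> H B -> P (A `&` B) = (P A * P B)%E.

Definition disjoint_systems {d1 d2} {X : measurableType d1}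
    {Y : measurableType d2} (mu : probability X R) (S : X -> X)
    (nu : probability Y R) (T : Y -> Y) : Prop :=
  forall d (Z : measurableType d) (P : probability Z R) (U : Z -> Z)
    (alpha : Z -> X) (beta : Z -> Y),
    measure_preserving P U ->
    factor_map P U mu S alpha -> factor_map P U nu T beta ->
    independent_classes P (preimage_set_system [set: Z] alpha measurable)
                          (preimage_set_system [set: Z] beta measurable).

End dynamical_systems.

(* Main.v *)
(** If an event [A] invariant under [T x T] had measure strictly between 0 and 1
    for [mu x nu], conditioning [mu x nu] on [A] would give an invariant measure
    whose marginals are invariant and absolutely continuous with respect to
    [mu] and [nu], hence equal to them by ergodicity.  Disjointness then forces
    the conditioned measure to be [mu x nu] itself, although it does not charge
    the complement of [A].  So [mu x nu] is ergodic for [T x T], and its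
    image [mu * nu] under the multiplication, which intertwines [T x T] and
    [T], is ergodic as well. *)
Require Import Defs.
From HB Require Import structures.
From mathcomp Require Import all_boot all_order all_algebra.
From mathcomp Require Import all_classical all_reals all_analysis.
From mathcomp Require Import lra.

Set Implicit Arguments.
Unset Strict Implicit.
Unset Printing Implicit Defensive.

Import Order.TTheory GRing.Theory Num.Theory.

Local Open Scope classical_set_scope.
Local Open Scope ring_scope.
Local Open Scope charge_scope.

(** * Preimages and Hahn-negative sets *)

Lemma measurable_preimageT d d' (X : measurableType d) (Y : measurableType d')
    (f : X -> Y) (A : set Y) :
  measurable_fun [set: X] f -> measurable A -> measurable (f @^-1` A).
Proof. by move=> mf mA; rewrite -[_ @^-1` _]setTI; exact: mf. Qed.

(** The negative part [N] has the least charge of all measurable sets. A subset [C] of [B] with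
    positive charge would leave [B] minus [C] with less charge than [N]. *)
Lemma hahn_negative_set_min d (X : measurableType d) (R : realType)
    (k : {charge set X -> \bar R}) (P N B : set X) :
  hahn_decomposition k P N -> measurable B -> k B = k N -> k.-negative_set B.
Proof.
move=> [[mP posP] [mN negN] PNT PN0] mB kBN; split=> // C mC CB.
have mD : measurable (B `\` C) by exact: measurableD.
have fin A : measurable A -> k A \is a fin_num by exact: fin_num_measure.
have mDP := measurableI _ _ mD mP; have mDN := measurableI _ _ mD mN.
have mND : measurable (N `\` (B `\` C)) by exact: measurableD.
have kB : k B = (k (B `\` C) + k C)%E.
  by rewrite (chargeDI k mB mC) (setIidr CB).
have kD := charge_partition k mD mP mN PNT PN0.
have kN : k N = (k (N `\` (B `\` C)) + k ((B `\` C) `&` N))%E.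
  by rewrite (chargeDI k mN mD) [N `&` _]setIC.
have kDP := posP _ mDP (@subIsetr _ _ _).
have kND := negN _ mND (@subDsetl _ _ _).
move: kB kD kN kDP kND; rewrite kBN.
rewrite -(fineK (fin _ mN)) -(fineK (fin _ mD)) -(fineK (fin _ mC)).
rewrite -(fineK (fin _ mDP)) -(fineK (fin _ mDN)) -(fineK (fin _ mND)).
rewrite -!EFinD => -[+] [+] [+]; rewrite !lee_fin => h1 h2 h3 h4 h5.
by lra.
Qed.

(** * Subinvariant sets and absolutely continuous invariant measures *)

Section ergodic_systems.
Context {R : realType} {d : measure_display} {X : measurableType d}.
Implicit Types (mu m : probability X R) (S : X -> X) (U : set X).

Lemma measurable_iter_preimage S n U :
  measurable_fun [set: X] S -> measurable U ->
  measurable (iter n (fun B => S @^-1` B) U).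
Proof.
by move=> mS mU; elim: n => //= n IHn; exact: measurable_preimageT.
Qed.

Lemma measure_iter_preimage mu S n U :
  measure_preserving mu S -> measurable U ->
  mu (iter n (fun B => S @^-1` B) U) = mu U.
Proof.
move=> [mS muS] mU; elim: n => //= n IHn.
by rewrite muS//; exact: measurable_iter_preimage.
Qed.

(* The intersection of the S^-n U is strictly invariant with the same measure. *)
Lemma ergodic_subinvariant mu S U :
  ergodic mu S -> measurable U -> S @^-1` U `<=` U -> mu U = 0%E \/ mu U = 1%E.
Proof.
move=> [mpS ergS] mU SU.
have mF n := @measurable_iter_preimage S n U mpS.1 mU.
pose F n := iter n (fun B => S @^-1` B) U.
have FS n : F n.+1 `<=` F n.
  by elim: n => [|n IHn]; [exact: SU|move=> x; exact: IHn].
have mV : measurable (\bigcap_n F n) by exact: bigcapT_measurable.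
have SV : S @^-1` (\bigcap_n F n) = \bigcap_n F n.
  apply/seteqP; split=> x h n _; last exact: (h n.+1 I).
  exact: (FS n x (h n I)).
have cF : mu \o F @ \oo --> mu (\bigcap_n F n).
  apply: nonincreasing_cvg_mu => //.
    by rewrite ltey_eq fin_num_measure.
  by apply/nonincreasing_seqP => n; apply/subsetPset; exact: FS.
have : mu \o F @ \oo --> mu U.
  rewrite (_ : mu \o F = cst (mu U)); first exact: cvg_cst.
  by apply/funext => n; exact: measure_iter_preimage.
move=> /(cvg_unique _ cF) <-; last exact: ereal_hausdorff.
exact: ergS.
Qed.

(* The sets S^-n N, for N negative in a Hahn decomposition of m - mu, minimize
   m - mu because N does, hence are negative; their union U is negative with a
   positive complement, and ergodicity decides which of the two is null. *)
Lemma ergodic_dominated_eq mu m S :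
  ergodic mu S -> measure_preserving m S ->
  (forall A, measurable A -> mu A = 0%E -> m A = 0%E) ->
  forall A, measurable A -> m A = mu A.
Proof.
move=> ergS mpm ac.
have [[mS muS] _] := ergS.
(* Both measures have total mass 1, so an inequality valid on all measurable sets reverses on
   passing to complements. *)
suff [lemu|gemu] : (forall A, measurable A -> m A <= mu A)%E \/
                 (forall A, measurable A -> mu A <= m A)%E.
- move=> A mA; apply/eqP; rewrite eq_le lemu//=.
  have := lemu _ (measurableC mA); rewrite !probability_setC//.
  by rewrite leeD2lE// leeN2.
- move=> A mA; apply/eqP; rewrite eq_le gemu// andbT.
  have := gemu _ (measurableC mA); rewrite !probability_setC//.
  by rewrite leeD2lE// leeN2.
pose k : {charge set X -> \bar R} :=
  cadd (charge_of_finite_measure m) (copp (charge_of_finite_measure mu)).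
have kE A : k A = (m A - mu A)%E by [].
have [P [N PN]] := Hahn_decomposition k.
have [[_ posP] [mN _] PNT _] := PN.
pose F n := iter n (fun B => S @^-1` B) N.
have mF n : measurable (F n) by exact: measurable_iter_preimage.
have negF n : k.-negative_set (F n).
  apply: (hahn_negative_set_min PN) => //.
  by rewrite !kE !measure_iter_preimage.
pose U := \bigcup_n F n.
have [mU negU] : k.-negative_set U by exact: bigcup_negative_set.
(* Pulling [U] back shifts the index and drops [F 0], which gives only an inclusion. *)
have SU : S @^-1` U `<=` U by move=> x [n _ Fx]; exists n.+1.
have UCP : ~` U `<=` P.
  move=> x Ux; have : [set: X] x by [].
  by rewrite -PNT => -[//|Nx]; case: Ux; exists 0%N.
have fin (q : probability X R) A : measurable A -> q A \is a fin_num.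
  exact: fin_num_measure.
have split_U (q : probability X R) A : measurable A ->
    q A = (q (A `\` U) + q (A `&` U))%E.
  by move=> mA; rewrite -measureDI.
have null (q : probability X R) A B : measurable A -> measurable B ->
    A `<=` B -> q B = 0%E -> q A = 0%E.
  by move=> mA mB AB; exact: subset_measure0.
(* Whichever of [U] and its complement is [mu]-null is also [m]-null by [ac], so only the sign of
   [k] on the other one matters. *)
have [U0|U1] := ergodic_subinvariant ergS mU SU.
- right=> A mA; have mAU := measurableI _ _ mA mU.
  have mAD := measurableD mA mU.
  rewrite (split_U mu)// (null mu (A `&` U) U)//.
  rewrite adde0 (split_U m)//.
  rewrite (null m (A `&` U) U)//; last exact: ac.
  rewrite adde0; have := posP _ mAD.
  rewrite kE sube_ge0 ?fin//; apply.
  by move=> x [_ Ux]; exact: UCP.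
- left=> A mA; have mAU := measurableI _ _ mA mU.
  have mAD := measurableD mA mU.
  have UC0 : mu (~` U) = 0%E by rewrite probability_setC// U1 subee.
  rewrite (split_U m)// (null m (A `\` U) (~` U))//.
  + rewrite add0e (split_U mu)//; apply: lee_paddl => //.
    have := negU _ mAU (@subIsetr _ _ _).
    by rewrite kE sube_le0.
  + exact: measurableC.
  + by apply: ac => //; exact: measurableC.
Qed.

End ergodic_systems.

(** * Images and products of systems *)

(** Since [f] intertwines [S] and [T], it pulls [T]-invariant sets back to [S]-invariant ones of the
    same measure. *)
Lemma ergodic_image {R : realType} d d' (X : measurableType d)
    (Y : measurableType d') (P : probability X R) (Q : probability Y R)
    (S : X -> X) (T : Y -> Y) (f : X -> Y) :
  measurable_fun [set: X] f -> measurable_fun [set: Y] T ->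
  (forall A, measurable A -> Q A = P (f @^-1` A)) ->
  (forall x, f (S x) = T (f x)) -> ergodic P S -> ergodic Q T.
Proof.
move=> mf mT QE fST [[mS PS] ergP].
have comm A : f @^-1` (T @^-1` A) = S @^-1` (f @^-1` A).
  by apply/seteqP; split=> x /=; rewrite fST.
split.
  split=> // A mA; rewrite !QE//; last exact: measurable_preimageT.
  by rewrite comm PS//; exact: measurable_preimageT.
move=> A mA TA; rewrite QE//; apply: ergP; first exact: measurable_preimageT.
by rewrite -comm TA.
Qed.

Section product_systems.
Context {R : realType} {d1 d2 : measure_display}.
Context {X : measurableType d1} {Y : measurableType d2}.
Variables (mu : probability X R) (nu : probability Y R).
Variables (S : X -> X) (T : Y -> Y).

Let ST (z : X * Y) := (S z.1, T z.2).

Lemma measure_preserving_prod :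
  measure_preserving mu S -> measure_preserving nu T ->
  measure_preserving (mu \x nu)%E (fun z => (S z.1, T z.2)).
Proof.
move=> [mS muS] [mT nuT].
have mST : measurable_fun [set: X * Y] ST.
  by apply: measurable_fun_pair;
    [exact: measurableT_comp mS measurable_fst
    |exact: measurableT_comp mT measurable_snd].
split=> // A mA; apply/esym.
(* The image measure [Q] agrees with the product on rectangles, which determine the product
   measure. *)
pose Q : probability (X * Y)%type R :=
  distribution (mu \x nu)%E (mfun_Sub (mem_set mST)).
apply: (product_measure_unique (m' := Q)) mA => B C mB mC.
transitivity (mu (S @^-1` B) * nu (T @^-1` C))%E; last by rewrite muS// nuT.
by rewrite -product_measure1E//; exact: measurable_preimageT.
Qed.

Lemma ergodic_prod :
  ergodic mu S -> ergodic nu T -> disjoint_systems mu S nu T ->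
  ergodic (mu \x nu)%E (fun z => (S z.1, T z.2)).
Proof.
move=> ergS ergT disj.
have mpST := measure_preserving_prod ergS.1 ergT.1.
split=> // A mA STA.
have [|A0] := eqVneq ((mu \x nu)%E A) 0%E; [by left|right].
pose r : {measure set (X * Y) -> \bar R} := mrestr (mu \x nu)%E mA.
(* [P] is the product conditioned on [A]. The second argument of [mnormalize] is a default for mass
   zero or infinity, excluded by [A0] and finiteness. *)
pose P : probability (X * Y)%type R := mnormalize r (mu \x nu)%E.
pose L : probability (X * Y)%type R := (mu \x nu)%E.
have finA : L A \is a fin_num by exact: fin_num_measure mA.
pose c := (fine ((mu \x nu)%E A))^-1%:E.
have PE B : P B = ((mu \x nu)%E (B `&` A) * c)%E.
  rewrite /P /= /mnormalize /= /mrestr setTI (negbTE A0) /=.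
  by rewrite -[X in (X == _)%E]fineK.
(* As [A] is its own preimage, intersecting with [A] commutes with pulling back by [ST]. *)
have mpP : measure_preserving P ST.
  split; first exact: mpST.1.
  move=> B mB; rewrite !PE -{1}STA -preimage_setI mpST.2//.
  exact: measurableI.
have null B : measurable B -> (mu \x nu)%E B = 0%E -> P B = 0%E.
  move=> mB B0; rewrite PE (_ : (mu \x nu)%E _ = 0%E) ?mul0e//.
  by apply: subset_measure0 B0 => //; exact: measurableI.
have marg1 B : measurable B -> (mu \x nu)%E (fst @^-1` B) = mu B.
  move=> mB; rewrite -setXT product_measure1E//.
  by rewrite /= probability_setT mule1.
have marg2 B : measurable B -> (mu \x nu)%E (snd @^-1` B) = nu B.
  move=> mB; rewrite -setTX product_measure1E//.
  by rewrite /= probability_setT mul1e.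
have ff : factor_map P ST mu S fst.
  split; [exact: measurable_fst| |exact: aeW].
  pose m : probability X R := distribution P
    (mfun_Sub (mem_set (@measurable_fst _ _ X Y))).
  apply: (ergodic_dominated_eq (m := m) ergS) => [|B mB B0].
    split; first exact: ergS.1.1.
    move=> B mB; rewrite -[RHS]mpP.2//.
    exact: measurable_preimageT measurable_fst mB.
  apply: null; first exact: measurable_preimageT measurable_fst mB.
  exact: etrans (marg1 _ mB) B0.
have fs : factor_map P ST nu T snd.
  split; [exact: measurable_snd| |exact: aeW].
  pose m : probability Y R := distribution P
    (mfun_Sub (mem_set (@measurable_snd _ _ X Y))).
  apply: (ergodic_dominated_eq (m := m) ergT) => [|B mB B0].
    split; first exact: ergT.1.1.
    move=> B mB; rewrite -[RHS]mpP.2//.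
    exact: measurable_preimageT measurable_snd mB.
  apply: null; first exact: measurable_preimageT measurable_snd mB.
  exact: etrans (marg2 _ mB) B0.
(* Comparing the two measures at [A] itself is enough, because [P A] is 1. *)
have PA : (mu \x nu)%E A = P A; last first.
  apply: (etrans PA).
  rewrite PE setIid /c -[X in (X * _)%E](fineK finA) -EFinM divff//.
  by rewrite fine_eq0.
(* On a rectangle, independence of the coordinates under [P] and the known marginals give the
   product formula. *)
apply: (product_measure_unique (m' := P) _ mA) => B C mB mC.
have [_ PB _] := ff; have [_ PC _] := fs.
rewrite /= -PB// -PC//; apply: disj mpP ff fs _ _ _ _.
- by exists B => //; rewrite setTI.
- by exists C => //; rewrite setTI.
Qed.

End product_systems.

(** * Ergodicity of the convolution *)

Theorem theorem4p1 (R : realType) (G : topologicalGroupType)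
    (cptG : compact [set: G]) (metG : metrizable R G)
    (T : {multiplicative G -> G}) (contT : continuous T)
    (surjT : set_surj [set: G] [set: G] T)
    (mu nu : probability (borel G) R)
    (muT : measure_preserving mu T) (nuT : measure_preserving nu T)
    (ergmu : ergodic mu T) (ergnu : ergodic nu T)
    (disj : disjoint_systems mu T nu T) :
  ergodic (convolution cptG metG mu nu) T.
Proof.
apply: ergodic_image (ergodic_prod ergmu ergnu disj).
- exact: measurable_mulg cptG metG.
- exact: muT.1.
- by move=> A mA; rewrite convolutionE.
- by move=> z; rewrite gmulfM.
Qed.
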